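(* For every positive integer $l'$ there is a constant $C_{l'}$ such that for all $n$, every $(n-l')$-trace $l'$-Sperner family $\mathcal{F}\subseteq 2^{[n]}$ satisfies $|\mathcal{F}|\le C_{l'}\, n^{-1/3}\binom{n}{\lfloor n/2\rfloor}$.
   Context: $[n]=\{1,\dots,n\}$. A chain of length $m$ is a sequence of sets $F_1\subsetneq\dots\subsetneq F_m$; a family is $k$-Sperner if it contains no chain of length $k+1$. For a family $\mathcal{F}$ and a set $X$, $\mathcal{F}|_X=\{F\cap X: F\in\mathcal{F}\}$. A family $\mathcal{F}\subseteq 2^{[n]}$ is $l$-trace $k$-Sperner if for every $l$-element subset $L\subseteq[n]$, the family $\mathcal{F}|_L$ is $k$-Sperner. *)

(* Defs.v *)
From mathcomp Require Import all_boot.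
From Stdlib Require Import Reals.
Set Implicit Arguments. Unset Strict Implicit. Unset Printing Implicit Defensive.

Definition is_chain (T : finType) (F : {set {set T}}) (s : seq {set T}) : bool :=
  all (fun A => A \in F) s && sorted (fun A B : {set T} => A \proper B) s.

Definition k_sperner (T : finType) (F : {set {set T}}) (k : nat) : Prop :=
  forall s, is_chain F s -> size s <= k.

Definition trace (T : finType) (F : {set {set T}}) (X : {set T}) : {set {set T}} :=
  [set A :&: X | A in F].

Definition trace_k_sperner (n : nat) (F : {set {set 'I_n}}) (l k : nat) : Prop :=
  forall L : {set 'I_n}, #|L| = l -> k_sperner (trace F L) k.

(* Main.v *)
(** Call an [l]-path in [F] a sequence [A_0, .., A_l] of members of [F] with
    [A_i = A_(i-1) - x_i + y_i], where no [y_i] occurs among the [x_j].  Deleting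
    [X = {x_1, .., x_l}] turns it into a strict chain of [l + 1] sets, so an
    [(n-l)]-trace [l]-Sperner family contains no [l]-path.  In the bipartite graph
    joining [A] in [F] to the sets [A - x], a subgraph with all degrees larger than
    [l] would yield such a path greedily; hence there is none, and the graph has at
    most [l (|F| + 2^n)] edges, i.e. the sum of [|A|] over [F] is at most [2 l 2^n].
    The same holds for the family of complements, so [n |F| <= 4 l 2^n], which is
    of order [n^(-1/2) 'C(n, n/2)]. *)

Require Import Defs.
From mathcomp Require Import all_boot zify.
From Stdlib Require Import Reals Lra.
(* Restores MathComp's [^] on [nat], which [Reals] overrides by [Nat.pow]. *)
Import ssrnat.
Set Implicit Arguments. Unset Strict Implicit. Unset Printing Implicit Defensive.

(** Delete vertices of [U] of degree at most [a] and vertices of [V] of degree at most [b] for as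
    long as there are any. A deletion lowers the left side by at least as much as the right, so the
    strict inequality survives; it fails for empty [U], so the process stops earlier. *)
Lemma dense_bipartite_core (T1 T2 : finType) (r : T1 -> T2 -> bool) (a b : nat)
    (U : {set T1}) (V : {set T2}) :
  a * #|U| + b * #|V| < \sum_(u in U) \sum_(v in V) r u v ->
  exists (U' : {set T1}) (V' : {set T2}), [/\ U' \subset U, U' != set0,
    {in U', forall u, a < #|[set v in V' | r u v]|} &
    {in V', forall v, b < #|[set u in U' | r u v]|}].
Proof.
have degE (T : finType) (W : {set T}) (p : pred T) :
    \sum_(w in W) p w = #|[set w in W | p w]|.
  rewrite -sum1_card big_mkcond [RHS]big_mkcond /=; apply: eq_bigr => w _.
  by rewrite inE; case: (w \in W); case: (p w).
have [m] := ubnP (#|U| + #|V|); elim: m U V => // m IHm U V ltm dense.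
have [/exists_inP [u uU lowu]|] :=
    boolP [exists u in U, #|[set v in V | r u v]| <= a].
  have [||U' [V' [sU' nzU' hU hV]]] := IHm (U :\ u) V.
  - by move: ltm; rewrite (cardsD1 u U) uU; lia.
  - move: dense; rewrite (big_setD1 u) //= degE (cardsD1 u U) uU; lia.
  by exists U', V'; split=> //; apply: subset_trans sU' (subD1set _ _).
move=> /exists_inPn highU.
have [/exists_inP [v vV lowv]|/exists_inPn highV] :=
    boolP [exists v in V, #|[set u in U | r u v]| <= b].
  apply: (IHm U (V :\ v)).
    by move: ltm; rewrite (cardsD1 v V) vV; lia.
  move: dense; rewrite exchange_big (big_setD1 v) //= degE (cardsD1 v V) vV.
  rewrite exchange_big /=; lia.
exists U, V; split=> //.
- by apply: contraTneq dense => ->; rewrite big_set0 ltn0.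
- by move=> u /highU; rewrite -ltnNge.
- by move=> v /highV; rewrite -ltnNge.
Qed.

Definition covers (T : finType) (A B : {set T}) : bool :=
  [exists x in A, B == A :\ x].

(** At most [#|Y|] of the counted sets arise by deleting an element of [Y], so another one
    remains. *)
Lemma covers_down_avoid (T : finType) (V : {set {set T}}) (A Y : {set T}) :
  #|Y| < #|[set B in V | covers A B]| ->
  exists x, [/\ x \in A, x \notin Y & A :\ x \in V].
Proof.
move=> big; have /subsetPn [B] :
    ~~ ([set B in V | covers A B] \subset [set A :\ x | x in Y]).
  apply: contraL big => /subset_leq_card le; rewrite -leqNgt.
  exact: leq_trans le (leq_imset_card _ _).
rewrite inE => /andP [BV /exists_inP [x xA /eqP eB]] nB.
exists x; split=> //; last by rewrite -eB.
by apply: contra nB => xY; apply/imsetP; exists x.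
Qed.

Lemma covers_up_avoid (T : finType) (U : {set {set T}}) (B X : {set T}) :
  #|X| < #|[set A in U | covers A B]| ->
  exists y, [/\ y \notin B, y \notin X & y |: B \in U].
Proof.
move=> big; have /subsetPn [A] :
    ~~ ([set A in U | covers A B] \subset [set y |: B | y in X]).
  apply: contraL big => /subset_leq_card le; rewrite -leqNgt.
  exact: leq_trans le (leq_imset_card _ _).
rewrite inE => /andP [AU /exists_inP [y yA /eqP eB]] nA.
have eA : A = y |: B by rewrite eB setD1K.
exists y; split; [by rewrite eB !inE eqxx | | by rewrite -eA].
by apply: contra nA => yX; apply/imsetP; exists y.
Qed.

Lemma card_covers (T : finType) (A : {set T}) :
  #|A| <= \sum_(B in [set: {set T}]) covers A B.
Proof.
have inj : {in A &, injective (fun x => A :\ x)}.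
  move=> x y xA yA /setP /(_ x); rewrite !inE eqxx xA andbT /=.
  by case: eqP.
rewrite -(card_in_imset inj) -sum1_card big_mkcond /=.
rewrite [leqRHS]big_mkcond /=; apply: leq_sum => B _; rewrite inE.
case: ifP => // /imsetP [x xA ->].
by rewrite (_ : covers _ _) //; apply/exists_inP; exists x.
Qed.

(* The chain [A :: s] is listed downwards; [Z] stands for the final set of deleted
   elements, of which only the part [X] is known after [i] steps. *)
Lemma swap_path (T : finType) (U V : {set {set T}}) (l : nat) :
  U != set0 ->
  {in U, forall A, l < #|[set B in V | covers A B]|} ->
  {in V, forall B, l < #|[set A in U | covers A B]|} ->
  forall i, i <= l ->
  exists (X Y A : {set T}) (s : seq {set T}),
    [/\ [/\ #|X| = i, #|Y| = i, size s = i & all (fun B => B \in U) (A :: s)],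
        Y \subset A, [disjoint X & A] &
        forall Z : {set T}, X \subset Z -> [disjoint Z & Y] ->
          sorted (fun B C : {set T} => C :\: Z \proper B :\: Z) (A :: s)].
Proof.
move=> /set0Pn [A0 A0U] degU degV; elim=> [_|i IHi lti].
  exists set0, set0, A0, [::]; rewrite /= A0U !cards0 sub0set.
  by split=> //; apply/pred0P => x; rewrite /= inE.
have [X [Y [A [s [[cX cY szs /andP [AU sU]] sYA dXA chain]]]]] := IHi (ltnW lti).
(* Avoiding [Y] keeps the elements inserted earlier in the current set. *)
have [x [xA xY BV]] : exists x, [/\ x \in A, x \notin Y & A :\ x \in V].
  by apply: covers_down_avoid; rewrite cY; apply: leq_trans (degU A AU); lia.
have xX : x \notin X by apply: contraTN xA => /(disjointFr dXA) ->.
(* Now [i + 1 <= l] elements are forbidden. Among them is [x], which [y \notin A :\ x] alone would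
   allow to be put back. *)
have [y [yB yX AU']] :
    exists y, [/\ y \notin A :\ x, y \notin x |: X & y |: (A :\ x) \in U].
  apply: covers_up_avoid; rewrite cardsU1 xX cX.
  by apply: leq_trans (degV _ BV); lia.
move: yX; rewrite !inE negb_or => /andP [yx yX].
have yA : y \notin A by apply: contra yB => yA; rewrite !inE yx.
have yY : y \notin Y by apply: contra yA; apply: (subsetP sYA).
exists (x |: X), (y |: Y), (y |: (A :\ x)), (A :: s); split.
- split; [by rewrite cardsU1 xX cX | by rewrite cardsU1 yY cY | by rewrite /= szs |].
  by rewrite /= AU' AU.
- apply/subsetP => z; rewrite !inE => /predU1P [->|zY]; first by rewrite eqxx.
  rewrite (subsetP sYA z zY) andbT.
  by apply/orP; right; apply: contraNneq xY => <-.
- apply/pred0P => z /=; rewrite !inE.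
  have [->|zx] := eqVneq z x; first by rewrite eq_sym (negPf yx).
  have [->|zy] := eqVneq z y; first by rewrite (negPf yX).
  rewrite /=; have [zX|//] := boolP (z \in X).
  by rewrite (disjointFr dXA zX).
move=> Z sXZ dZY; have xZ : x \in Z by apply: (subsetP sXZ); rewrite !inE eqxx.
have yZ : y \notin Z by rewrite (disjointFl dZY) // !inE eqxx.
rewrite /= -/(sorted _ (A :: s)) chain ?andbT.
(* The swap loses only [x], which lies in [Z], and gains [y] outside [Z], so the inclusion is
   strict. *)
- apply/properP; split.
    apply/subsetP => z; rewrite !inE => /andP [zZ zA]; rewrite zZ zA andbT /=.
    by apply/orP; right; apply: contraNneq zZ => ->.
  by exists y; rewrite !inE ?eqxx ?yZ ?(negPf yA).
- by apply: subset_trans sXZ; apply: subsetUr.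
- by apply: disjointWr dZY; apply: subsetUr.
Qed.

Lemma trace_sperner_sum_card (n l : nat) (F : {set {set 'I_n}}) :
  trace_k_sperner F (n - l) l -> \sum_(A in F) #|A| <= 2 * l * 2 ^ n.
Proof.
move=> trF; rewrite leqNgt; apply/negP => big.
have cardT : #|[set: {set 'I_n}]| = 2 ^ n.
  by rewrite -powersetT card_powerset cardsT card_ord.
have leF : #|F| <= 2 ^ n by rewrite -cardT subset_leq_card ?subsetT.
have dense : l * #|F| + l * #|[set: {set 'I_n}]|
    < \sum_(A in F) \sum_(B in [set: {set 'I_n}]) covers A B.
  apply: leq_trans (leq_sum _ (fun A _ => card_covers A)).
  by apply: leq_ltn_trans big; rewrite cardT; nia.
have [U [V [sUF nzU degU degV]]] := dense_bipartite_core dense.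
have [X [Y [A [s [[cX _ szs sU] sYA dXA chain]]]]] :=
  swap_path nzU degU degV (leqnn l).
have cL : #|~: X| = n - l by rewrite cardsCs setCK cX card_ord.
(* The [l + 1] sets are listed downwards, hence [rev]; intersecting with [~: X] is removing [X]. *)
have := trF _ cL (rev [seq B :\: X | B <- A :: s]).
rewrite size_rev size_map /= szs ltnn => absurd.
suff /absurd : is_chain (trace F (~: X)) (rev [seq B :\: X | B <- A :: s]) by [].
apply/andP; split.
  rewrite all_rev all_map; apply: sub_all sU => B BU /=.
  by apply/imsetP; exists B; rewrite ?(subsetP sUF) ?setDE.
rewrite rev_sorted sorted_map; apply: chain => //.
exact: disjointWr sYA dXA.
Qed.

(** Complementation inside [L] carries the trace of the complements to the trace of [F] and reverses
    chains; strictness survives because all sets involved lie in [L]. *)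
Lemma trace_k_sperner_setC (n l k : nat) (F : {set {set 'I_n}}) :
  trace_k_sperner F l k -> trace_k_sperner [set ~: A | A in F] l k.
Proof.
move=> trF L cL s /andP [sT chain].
have subL B : B \in s -> B \subset L.
  by move=> /(allP sT) /imsetP [A _ ->]; apply: subsetIr.
have := trF L cL (rev [seq L :\: B | B <- s]).
rewrite size_rev size_map; apply; apply/andP; split.
  rewrite all_rev all_map; apply: sub_all sT => B /imsetP [_ /imsetP [A AF ->] ->] /=.
  apply/imsetP; exists A => //; apply/setP => z; rewrite !inE.
  by case: (z \in A); case: (z \in L).
rewrite rev_sorted sorted_map.
apply: (sub_in_sorted (P := mem s)) chain; last exact/allP.
move=> B C /subL sBL /subL sCL /= /properP [sBC [z zC zB]].
apply/properP; split; first exact: setDS.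
by exists z; rewrite !inE ?zC ?zB ?(subsetP sCL z zC).
Qed.

Lemma trace_sperner_card (n l : nat) (F : {set {set 'I_n}}) :
  trace_k_sperner F (n - l) l -> n * #|F| <= 4 * l * 2 ^ n.
Proof.
move=> trF; have h1 := trace_sperner_sum_card trF.
have := trace_sperner_sum_card (trace_k_sperner_setC trF).
rewrite big_imset /=; last by move=> A B _ _; apply: setC_inj.
have : \sum_(A in F) #|A| + \sum_(A in F) #|~: A| = n * #|F|.
  rewrite -big_split /= (eq_bigr (fun=> n)) ?sum_nat_const 1?mulnC //.
  by move=> A _; rewrite cardsC card_ord.
move=> <-; move: h1; rewrite -!mulnA.
by move: (\sum_(A in F) #|A|) (\sum_(A in F) #|~: A|) (l * 2 ^ n); lia.
Qed.

Lemma bin_middle (m : nat) : 'C(m.+1.*2, m.+1) = 2 * 'C(m.*2.+1, m).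
Proof.
rewrite doubleS binS -[in X in X + _]bin_sub; last by lia.
by rewrite (_ : m.*2.+1 - m.+1 = m); lia.
Qed.

(** With k = m + 1, the ratio of consecutive central coefficients is 2(2k + 1)/(k + 1), and the
    induction step reduces to 4k(k + 1) <= (2k + 1)^2. *)
Lemma central_bin_lower (m : nat) :
  16 ^ m.+1 <= 4 * m.+1 * 'C(m.+1.*2, m.+1) ^ 2.
Proof.
elim: m => [|m IHm] //.
have step : m.+2 * 'C(m.+2.*2, m.+2) = 2 * (m.+1.*2.+1 * 'C(m.+1.*2, m.+1)).
  rewrite bin_middle mul_bin_diag -[in LHS]bin_sub; last by lia.
  by rewrite (_ : m.+1.*2.+1 - m.+1 = m.+2); lia.
move: step IHm; set c := 'C(m.+2.*2, _); set d := 'C(_, _) => step IHm.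
rewrite -(leq_pmul2l (ltn0Sn m.+1)).
have -> : m.+2 * (4 * m.+2 * c ^ 2) = 4 * (m.+2 * c) ^ 2.
  by rewrite expnMn; lia.
rewrite step !expnMn.
apply: (@leq_trans (m.+2 * (16 * (4 * m.+1 * d ^ 2)))).
  by rewrite [16 ^ m.+2]expnS !leq_mul2l IHm !orbT.
have -> : m.+2 * (16 * (4 * m.+1 * d ^ 2)) = 64 * (m.+2 * m.+1) * d ^ 2 by lia.
rewrite !mulnA; apply: leq_mul => //; lia.
Qed.

Lemma middle_bin_lower (n : nat) : 0 < n -> 4 ^ n <= 4 * n * 'C(n, n./2) ^ 2.
Proof.
rewrite -{1 2 3 4}[n]odd_double_half; case: (odd n) n./2 => [] m /=.
  (* For odd n = 2m + 1, pass to the central coefficient of 2m + 2, which is twice the middle one of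
     n. *)
  rewrite add1n => _; have := central_bin_lower m; rewrite bin_middle expnMn.
  have -> : 16 ^ m.+1 = 4 * 4 ^ m.*2.+1.
    by rewrite -[16]/(4 ^ 2) -expnM -expnS; congr (4 ^ _); lia.
  move: ('C(_, _) ^ 2) => c; nia.
case: m => // m _; have := central_bin_lower m.
have -> : 16 ^ m.+1 = 4 ^ m.+1.*2.
  by rewrite -[16]/(4 ^ 2) -expnM; congr (4 ^ _); lia.
rewrite add0n; move: ('C(_, _) ^ 2) => c; nia.
Qed.

(** Squaring keeps the factor n^(-1/2) within [nat]. The 8 is the 4 of [trace_sperner_card] times
    the 2 in 2^n <= 2 n^(1/2) 'C(n, n./2). *)
Lemma trace_sperner_card_sqr (n l : nat) (F : {set {set 'I_n}}) : 0 < n ->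
  trace_k_sperner F (n - l) l -> n * #|F| ^ 2 <= (8 * l * 'C(n, n./2)) ^ 2.
Proof.
move=> n0 /trace_sperner_card le1; have le2 := middle_bin_lower n0.
rewrite -(leq_pmul2l n0).
have -> : n * (n * #|F| ^ 2) = (n * #|F|) ^ 2 by rewrite expnMn; lia.
apply: (@leq_trans ((4 * l * 2 ^ n) ^ 2)); first by rewrite leq_sqr.
have -> : (4 * l * 2 ^ n) ^ 2 = 4 ^ 2 * l ^ 2 * 4 ^ n.
  by rewrite !expnMn -expnM [n * 2]mulnC expnM.
rewrite !expnMn.
have -> : n * (8 ^ 2 * l ^ 2 * 'C(n, n./2) ^ 2) =
          4 ^ 2 * l ^ 2 * (4 * n * 'C(n, n./2) ^ 2) by lia.
by rewrite leq_mul2l le2 orbT.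
Qed.

Theorem theorem3p2 :
  forall l' : nat, 0 < l' ->
  exists C : R,
    forall (n : nat) (F : {set {set 'I_n}}),
      0 < n ->
      trace_k_sperner F (n - l') l' ->
      (INR #|F| <= C * Rpower (INR n) (- (1 / 3)) * INR 'C(n, n./2))%R.
Proof.
move=> l' _; exists (INR (8 * l')) => n F n0 trF.
have /leP/le_INR := trace_sperner_card_sqr n0 trF.
set f := #|F|; set c := 'C(_, _).
rewrite -!mulnn -!multE !mult_INR.
have n1 : (1 <= INR n)%R by apply: (le_INR 1); apply/leP.
set t := Rpower _ _; have t0 : (0 < t)%R by apply: exp_pos.
have t3 : (t * t * t * INR n = 1)%R.
  rewrite -[X in (_ * X)%R](Rpower_1 (INR n)); last lra.
  rewrite -!Rpower_plus -(Rpower_O (INR n)); last lra.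
  by congr Rpower; field.
have t1 : (t <= 1)%R.
  rewrite -(Rpower_O (INR n)); last lra.
  by apply: Rle_Rpower; lra.
move: (pos_INR f) (pos_INR c) (pos_INR l').
move: (INR f) (INR c) (INR l') (INR n) n1 t0 t3 t1.
move=> x y z w w1 t0 t3 t1 x0 y0 z0 le.
apply: Rsqr_incr_0_var; last first.
  by apply: Rmult_le_pos => //; apply: Rmult_le_pos; [simpl; nra | lra].
rewrite /Rsqr; set k := (INR 8 * z * y)%R in le.
have -> : (INR 8 * z * t * y = k * t)%R by rewrite /k; ring.
(* The rate n^(-1/2) is t^(3/2), at most t since t <= 1. In squares: x^2 = t^3 (w x^2) <= t^3 k^2 <=
   (k t)^2. *)
apply: (@Rle_trans _ (t * t * t * (k * k))%R); last first.
  have := Rle_0_sqr (k * t); rewrite /Rsqr; nra.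
have -> : (x * x = t * t * t * (w * (x * x)))%R.
  by rewrite -[LHS]Rmult_1_l -t3; ring.
by apply: Rmult_le_compat_l => //; have := Rmult_lt_0_compat _ _ t0 t0; nra.
Qed.
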